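(* Let $S$ be a finite nonempty set, $W=\mathbb Z^+=\{0,1,2,\dots\}$, $\Gamma=S^{\mathbb Z^+}$ with its Borel $\sigma$-algebra $\mathcal B$, and let $P(x,\cdot)$ be a transition probability kernel on $(\Gamma,\mathcal B)$ satisfying conditions (A1)–(A4) and (A6) (listed in the context). Assume additionally that there exists only one time-invariant Borel probability measure $\nu_{TI}$ on $\Gamma$ with respect to $P$. Let $\mu$ be a Borel probability measure on $\Gamma$ with $I(\mu)<\infty$. Then the sequence of measures $\mu_n$, $n\ge1$, defined by $\mu_n(A)=\mu(\theta_n^{-1}(A))$ for $A\in\mathcal B$, converges weakly to $\nu_{TI}$.
   Context: $\Gamma=S^W$ carries the product of the discrete topologies; $M(\Gamma)$ is the set of Borel probability measures on $\Gamma$. For $\Phi\subset\Psi\subset W$, $\pi_\Phi:S^\Psi\to S^\Phi$ is the natural projection (restriction), and for a site $z\in\Psi$, $\pi_z(u)=u(z)$. For an integer $n>0$, $\theta_n:\Gamma\to\Gamma$ is the left shift $(\theta_n x)(z)=x(z+n)$, $z\in\mathbb Z^+$, and $\theta_n^{-1}(A)=\{y\in\Gamma:\theta_n(y)\in A\}$. Conditions: (A1) For all $x\in\Gamma$, any finite $\Phi\subset W$ and each $v\in S^\Phi$, $P(x,\{y\in\Gamma:\pi_\Phi(y)=v\})=\prod_{z\in\Phi}P(x,\{y\in\Gamma:\pi_z(y)=\pi_z(v)\})$. (A2) For any $z\in W$ there exist a finite set $N(z)\subset W$ with $z\in N(z)$ and a local transition kernel $P_z:S^{N(z)}\times S\to[0,1]$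 (i.e. $P_z(h,\cdot)$ is a probability distribution on $S$ for each $h\in S^{N(z)}$) such that $P(x,\{y\in\Gamma:\pi_z(y)=s\})=P_z(\pi_{N(z)}(x),s)$ for all $x\in\Gamma$, $s\in S$. (A3) $P_z(v,s)>0$ for all $z\in W$, $v\in S^{N(z)}$, $s\in S$. (A4) For any $z\in W$ the set $D(z)=\{z'\in W: z\in N(z')\}$ is finite. (A6) There is a positive integer $r_0$, independent of $z$, such that $N(z)=\{z,z+1,\dots,z+r_0\}$ for all $z\in\mathbb Z^+$, and $P_{z+n}(w,s)=P_z(\tilde\theta_n(w),s)$ for all $z\in\mathbb Z^+$, integers $n>0$, $w\in S^{N(z+n)}$, $s\in S$, where $\tilde\theta_n(w)\in S^{N(z)}$ is given by $\tilde\theta_n(w)(y)=w(y+n)$ for $y\in N(z)$. A measure $\nu\in M(\Gamma)$ is time-invariant with respect to $P$ if $\int_\Gamma P(x,A)\,\nu(dx)=\nu(A)$ for all $A\in\mathcal B$. Donsker–Varadhan action functional: for $\nu\in M(\Gamma)$, $$I(\nu)=-\inf_{f}\int_\Gamma\log\left(\frac{\int_\Gamma f(y)P(x,dy)}{f(x)}\right)\nu(dx)\in[0,\infty],$$ where the infimum is over all positive continuous functions $f$ on $\Gamma$. *)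

(* Defs.v *)
From HB Require Import structures.
From mathcomp Require Import all_boot all_order all_algebra finmap.
From mathcomp Require Import all_classical all_reals all_analysis.

Set Implicit Arguments.
Unset Strict Implicit.
Unset Printing Implicit Defensive.

Import Order.TTheory GRing.Theory Num.Theory.
Import numFieldNormedType.Exports.

Local Open Scope classical_set_scope.
Local Open Scope ring_scope.

(* Measurable types are pointed in the library; for a finite type, having a
   distinguished point amounts to being nonempty. *)
#[short(type="pfinType")]
HB.structure Definition PointedFinite := {T of Finite T & Pointed T}.

Definition config (S : pfinType) : Type :=
  prod_topology (fun _ : nat => discrete_topology S).

HB.instance Definition _ (S : pfinType) := Pointed.on (config S).
HB.instance Definition _ (S : pfinType) := Uniform.on (config S).

HB.instance Definition _ (S : pfinType) :=
  @isMeasurable.Build (sigma_display (@open (config S))) (config S)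
    <<s @open (config S) >> (@sigma_algebra0 _ setT _)
    (@sigma_algebraC _ _) (@sigma_algebra_bigcup _ setT _).

Lemma prod_shift_continuous (T : topologicalType) n :
  continuous ((fun x z => x (z + n)%N) :
    prod_topology (fun _ : nat => T) -> prod_topology (fun _ : nat => T)).
Proof.
move=> x; apply/cvg_sup; first exact/fmap_filter/nbhs_filter.
move=> i; move: x.
apply/(@continuousP _ (initial_topology (@^~ i))) => A [B oB E].
have -> : (fun (x : prod_topology (fun _ : nat => T)) z => x (z + n)%N) @^-1` A
    = @proj _ (fun _ : nat => T) (i + n)%N @^-1` B by rewrite -E.
by apply: open_comp => // x _; exact: proj_continuous.
Qed.

Section configurations.
Context {S : pfinType}.
Implicit Types x : config S.

Definition restr (Phi : {fset nat}) x : {ffun Phi -> S} :=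
  [ffun z => x (fsval z)].

Definition left_shift (n : nat) x : config S := fun z => x (z + n)%N.

Lemma left_shift_continuous n : continuous (left_shift n).
Proof. exact: (@prod_shift_continuous (discrete_topology S) n). Qed.

Lemma left_shift_measurable n : measurable_fun [set: config S] (left_shift n).
Proof.
apply: (measurability (@open (config S))) => // _ [A oA <-].
rewrite setTI; apply: sub_sigma_algebra.
by move/continuousP: (@left_shift_continuous n); apply.
Qed.

HB.instance Definition _ n :=
  isMeasurableFun.Build _ _ _ _ (left_shift n) (left_shift_measurable n).

End configurations.

Section neighbourhoods.
Context {S : pfinType}.
Implicit Types N : nat -> {fset nat}.

Definition homogeneous_neighbourhoods N (r : nat) :=
  forall z, N z = [fset y in iota z r.+1]%fset.

Lemma shift_mem N r (HN : homogeneous_neighbourhoods N r) z n (y : N z) :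
  (fsval y + n)%N \in N (z + n)%N.
Proof.
have mem_N a b : (b \in N a) = (a <= b < a + r.+1)%N.
  by rewrite HN in_fset; exact: (mem_iota a r.+1 b).
by have := fsvalP y; rewrite !mem_N leq_add2r addnAC ltn_add2r.
Qed.

Definition shift_window N r (HN : homogeneous_neighbourhoods N r) z n
    (w : {ffun N (z + n)%N -> S}) : {ffun N z -> S} :=
  [ffun y => w [` shift_mem HN n y]%fset].

End neighbourhoods.

Section conditions.
Context {R : realType} {S : pfinType}.
Variable P : R.-pker config S ~> config S.
Variable N : nat -> {fset nat}.
Variable p : forall z : nat, {ffun N z -> S} -> S -> R.

Definition independent_updates :=
  forall (x : config S) (Phi : {fset nat}) (v : {ffun Phi -> S}),
    P x [set y : config S | restr Phi y = v] =
    (\prod_(z : Phi) P x [set y : config S | y (fsval z) = v z])%E.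

Definition local_updates :=
  forall z : nat,
    [/\ z \in N z,
        forall h : {ffun N z -> S},
          (forall s, 0 <= p h s) /\ \sum_(s : S) p h s = 1
      & forall (x : config S) (s : S),
          P x [set y : config S | y z = s] = (p (restr (N z) x) s)%:E].

Definition positive_rates :=
  forall (z : nat) (v : {ffun N z -> S}) (s : S), 0 < p v s.

Definition finite_influence :=
  forall z : nat, finite_set [set z' : nat | z \in N z'].

Definition shift_homogeneous :=
  exists2 r : nat, (0 < r)%N & exists HN : homogeneous_neighbourhoods N r,
    forall z n : nat, (0 < n)%N ->
    forall (w : {ffun N (z + n)%N -> S}) (s : S),
      p w s = p (shift_window HN w) s.

End conditions.

Section measures.
Context {R : realType} {S : pfinType}.

Definition time_invariant (P : R.-pker config S ~> config S)
    (nu : probability (config S) R) :=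
  forall A : set (config S), measurable A -> (\int[nu]_x P x A = nu A)%E.

(* Library measures carry unspecified values on nonmeasurable sets, so
   uniqueness is agreement on Borel sets rather than equality of terms. *)
Definition unique_time_invariant (P : R.-pker config S ~> config S)
    (nu : probability (config S) R) :=
  time_invariant P nu /\
  forall nu' : probability (config S) R, time_invariant P nu' ->
    forall A : set (config S), measurable A -> nu' A = nu A.

Definition DV_action (P : R.-pker config S ~> config S)
    (nu : probability (config S) R) : \bar R :=
  (- ereal_inf [set \int[nu]_x (ln ((\int[P x]_y f y)%R / f x)%R)%:E
      | f in [set f : config S -> R | continuous f /\ forall x, (0 < f x)%R]])%E.

Definition weak_cvg (mu_ : nat -> probability (config S) R)
    (nu : probability (config S) R) :=
  forall f : config S -> R, continuous f ->
    (exists M : R, forall x, `|f x| <= M) ->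
    \int[mu_ n]_x f x @[n --> \oo] --> \int[nu]_x f x.

End measures.

(* Main.v *)
(* Write Ph(x) for the integral of h against P(x, .), and L_n(h) for the
   integral of ln (Ph / h) against mu_n, where h is a positive cylinder function.
   If h_j is the translate of h by n_j and the n_j are far enough apart, the h_j
   depend on disjoint sets of sites, so (A1) and (A6) give
   P(h_1 ... h_J) = Ph_1 ... Ph_J. Testing the action functional on the product
   h_1 ... h_J shows L_{n_1}(h) + ... + L_{n_J}(h) >= - I(mu) for every J, whence
   liminf L_n(h) >= 0. For h = 1 + e g with e small this says that the integral
   of Pg - g against mu_n tends to 0, for every cylinder function g, so that all
   limit points of (mu_n) are time-invariant and equal nuTI. Limit points are
   taken along ultrafilters: the limits of the mu_n(A), for A a cylinder set,
   define a content on the algebra of cylinder sets, which is countably additive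
   by compactness and extends to a measure by Caratheodory's theorem. *)
Require Import Defs.
From HB Require Import structures.
From mathcomp Require Import all_boot all_order all_algebra finmap.
From mathcomp Require Import all_classical all_reals all_analysis.
From mathcomp Require Import ring lra.
Import Order.TTheory GRing.Theory Num.Theory.
Import numFieldNormedType.Exports.

Set Implicit Arguments.
Unset Strict Implicit.
Unset Printing Implicit Defensive.

Local Open Scope classical_set_scope.
Local Open Scope ring_scope.

(** * Cylinder functions and the product topology *)

Section cylinders.
Context {S : pfinType}.
Implicit Types (x y : config S) (k m n : nat).

Definition block k x : {ffun 'I_k -> S} := [ffun i : 'I_k => x i].

(** The value [point] at the sites from [k] on is arbitrary: a function of the first [k] sites is
    recovered from its values at the finitely many configurations [extend v]. *)
Definition extend k (v : {ffun 'I_k -> S}) : config S :=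
  fun z => oapp v point (insub z).

(** Initial windows suffice, since every finite set of sites lies in one. With [T := Prop] the same
    notion describes cylinder sets. *)
Definition depends_below (T : Type) k (f : config S -> T) :=
  forall x y, (forall i, (i < k)%N -> x i = y i) -> f x = f y.

Definition cylinder (T : Type) (f : config S -> T) :=
  exists k, depends_below k f.

Lemma extend_ord k (v : {ffun 'I_k -> S}) (i : 'I_k) : extend v i = v i.
Proof. by rewrite /extend valK. Qed.

Lemma blockP k x y :
  block k x = block k y <-> forall i, (i < k)%N -> x i = y i.
Proof.
split=> [/ffunP xy i ik|xy]; first by have := xy (Ordinal ik); rewrite !ffunE.
by apply/ffunP => i; rewrite !ffunE xy.
Qed.

Lemma extend_block k x i : (i < k)%N -> extend (block k x) i = x i.
Proof. by move=> ik; rewrite -[i]/(val (Ordinal ik)) extend_ord ffunE. Qed.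

Section depends_below.
Variable T : Type.
Implicit Types f : config S -> T.

Lemma depends_belowE k f x :
  depends_below k f -> f x = f (extend (block k x)).
Proof. by apply => i ik; rewrite extend_block. Qed.

Lemma depends_below_le k m f :
  (k <= m)%N -> depends_below k f -> depends_below m f.
Proof.
by move=> km fk x y xy; apply: fk => i ik; apply: xy; exact: leq_trans ik km.
Qed.

Lemma depends_below_shift k n f :
  depends_below k f -> depends_below (k + n) (f \o left_shift n).
Proof.
by move=> fk x y xy; apply: fk => i ik; apply: xy; rewrite ltn_add2r.
Qed.

Lemma depends_below_op (T1 T2 : Type) (op : T1 -> T2 -> T) k
    (f1 : config S -> T1) (f2 : config S -> T2) :
  depends_below k f1 -> depends_below k f2 ->
  depends_below k (fun x => op (f1 x) (f2 x)).
Proof. by move=> fk gk x y xy; rewrite (fk x y)// (gk x y). Qed.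

Lemma depends_below_comp (T1 : Type) (h : T1 -> T) k (f : config S -> T1) :
  depends_below k f -> depends_below k (h \o f).
Proof. by move=> fk x y xy /=; rewrite (fk x y). Qed.

End depends_below.

Lemma cylinder_shift (T : Type) n (f : config S -> T) :
  cylinder f -> cylinder (f \o left_shift n).
Proof. by move=> [k fk]; exists (k + n)%N; exact: depends_below_shift. Qed.

Lemma cylinder_comp (T1 T : Type) (h : T1 -> T) (f : config S -> T1) :
  cylinder f -> cylinder (h \o f).
Proof. by move=> [k fk]; exists k; exact: depends_below_comp. Qed.

Lemma cylinder_op (T1 T2 T : Type) (op : T1 -> T2 -> T)
    (f1 : config S -> T1) (f2 : config S -> T2) :
  cylinder f1 -> cylinder f2 -> cylinder (fun x => op (f1 x) (f2 x)).
Proof.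
move=> [k1 fk1] [k2 fk2]; exists (maxn k1 k2); apply: depends_below_op.
  by apply: depends_below_le fk1; exact: leq_maxl.
by apply: depends_below_le fk2; exact: leq_maxr.
Qed.

Lemma left_shift0 x : left_shift 0 x = x.
Proof. by apply/funext => z; rewrite /left_shift addn0. Qed.

Lemma nbhs_block k x : nbhs x [set y | block k y = block k x].
Proof.
have H i : nbhs x [set y | y i = x i].
  have /= := @proj_continuous nat (fun _ => discrete_topology S) i x [set x i].
  apply; rewrite nbhs_principalE; exact/principal_filterP.
elim: k => [|k IH].
  by apply: filterS filterT => y _; apply/blockP.
apply: filterS2 (H k) IH => y /= yk /blockP yx; apply/blockP => i.
by rewrite ltnS leq_eqVlt => /predU1P[->//|]; exact: yx.
Qed.

Lemma cylinder_open (A : set (config S)) : cylinder A -> open A.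
Proof.
move=> [k Ak]; rewrite openE => x Ax; apply: filterS (nbhs_block k x) => y.
by move=> /blockP yx; rewrite (Ak _ _ yx).
Qed.

Lemma cylinder_measurable (A : set (config S)) : cylinder A -> measurable A.
Proof. by move=> /cylinder_open oA; exact: sub_sigma_algebra. Qed.

Lemma block_measurable k (B : set {ffun 'I_k -> S}) :
  measurable (block k @^-1` B).
Proof.
apply: cylinder_measurable; exists k => x y /blockP xy.
by rewrite /preimage/= xy.
Qed.

(** A cylinder function is locally constant, so [T] may carry any topology. *)
Lemma cylinder_continuous (T : topologicalType) (f : config S -> T) :
  cylinder f -> continuous f.
Proof.
move=> [k fk] x U /nbhs_singleton Ux; apply: filterS (nbhs_block k x) => y.
by move=> /blockP yx; rewrite /preimage/= (fk _ _ yx).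
Qed.

Lemma config_compact : compact [set: config S].
Proof.
have := @tychonoff nat (fun _ => discrete_topology S) (fun _ => setT).
rewrite (_ : [set f | _] = setT).
  by apply => i; exact/finite_compact/(@finite_finset S setT).
by apply/seteqP; split.
Qed.

(** The block cylinders around [x] generate a filter [F]. The product topology is a supremum of
    initial topologies, so it is enough that [F] contains the neighbourhoods of [x] for each
    coordinate separately. *)
Lemma nbhs_blockP x (U : set (config S)) :
  nbhs x U -> exists k, [set y | block k y = block k x] `<=` U.
Proof.
pose F := [set V : set (config S) |
  exists k, [set y | block k y = block k x] `<=` V].
have FF : Filter F.
  split=> [|A B [k kA] [m mB]|A B AB [k kA]]; first by exists 0%N.
    exists (maxn k m) => y /= /blockP yx; split; [apply: kA|apply: mB];
      apply/blockP => i ik; apply: yx; rewrite leq_max ik ?orbT//.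
  by exists k; exact: subset_trans AB.
suff : F `=>` nbhs x by apply.
apply/cvg_sup => i V [A [[B oB <-] Bx] BV].
exists i.+1 => y /= /blockP yx; apply: BV.
by rewrite /preimage/= yx.
Qed.

End cylinders.

(** * Integrals of finitely valued functions *)

Lemma fin_num_mass1 d (T : measurableType d) (R : realType)
    (mu : {measure set T -> \bar R}) (A : set T) :
  mu setT = 1%E -> measurable A -> mu A \is a fin_num.
Proof.
move=> muT mA; rewrite ge0_fin_numE// (@le_lt_trans _ _ (mu setT))//.
  by apply: le_measure => //; rewrite inE.
by rewrite muT ltry.
Qed.

Section finitely_valued.
Context d (T : measurableType d) (R : realType) (I : finType).
Variables (mu : {measure set T -> \bar R}) (c : T -> I).
Hypothesis muT : mu setT = 1%E.
Hypothesis mc : forall B : set I, measurable (c @^-1` B).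

Lemma measurable_finitely_valued (F : I -> R) :
  measurable_fun setT (fun x => F (c x)).
Proof. by move=> _ B mB; rewrite setTI; exact: (mc (F @^-1` B)). Qed.

Lemma integrable_finitely_valued (F : I -> R) :
  mu.-integrable setT (fun x => (F (c x))%:E).
Proof.
apply: measurable_bounded_integrable => //.
- by rewrite muT ltry.
- exact: measurable_finitely_valued.
- exists (\sum_i `|F i|); split; first by rewrite num_real.
  move=> M FM x _ /=; apply: le_trans (ltW FM).
  by rewrite (bigD1 (c x))//= lerDl sumr_ge0.
Qed.

(** The map [c] is kept general because it serves for blocks, for shifted blocks and for pairs of
    blocks. *)
Lemma Rintegral_finitely_valued (F : I -> R) :
  \int[mu]_x F (c x) = \sum_i F i * fine (mu (c @^-1` [set i])).
Proof.
rewrite /Rintegral.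
have -> : (\int[mu]_x (F (c x))%:E =
    \int[mu]_x \sum_i ((F i)%:E * ((c x == i)%:R)%:E))%E.
  apply: eq_integral => x _; rewrite (bigD1 (c x))//= big1 => [|i ic].
    by rewrite adde0 eqxx mule1.
  by rewrite eq_sym (negbTE ic) mule0.
have ic i : mu.-integrable setT (fun x => (c x == i)%:R%:E).
  exact: (@integrable_finitely_valued (fun j => (j == i)%:R)).
rewrite integral_sum//; last by move=> i; exact: integrableZl.
rewrite (eq_bigr (fun i => (F i * fine (mu (c @^-1` [set i])))%:E)) => [|i _].
  by rewrite sumEFin.
rewrite integralZl// EFinM fineK ?(fin_num_mass1 muT)//; congr (_ * _)%E.
rewrite (eq_integral (fun x => (\1_(c @^-1` [set i]) x)%:E)).
  by rewrite integral_indic// setIT.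
move=> x _; rewrite indicE; congr (_%:R%:E); have [ci|ci] := eqVneq (c x) i.
  by rewrite mem_set.
by rewrite memNset//= => /eqP; exact/negP.
Qed.

End finitely_valued.

Lemma Rintegral_const d (T : measurableType d) (R : realType)
    (mu : {measure set T -> \bar R}) (a : R) :
  mu setT = 1%E -> \int[mu]_x a = a.
Proof. by move=> muT; rewrite Rintegral_cst// muT mulr1. Qed.

Section config_integrals.
Context {R : realType} {S : pfinType}.
Variable mu : {measure set (config S) -> \bar R}.
Hypothesis muT : mu setT = 1%E.
Implicit Types (x y : config S) (k m n : nat) (f g : config S -> R).

Lemma block_shift_measurable k n (B : set {ffun 'I_k -> S}) :
  measurable ((fun x => block k (left_shift n x)) @^-1` B).
Proof.
have := left_shift_measurable n measurableT (block_measurable B).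
by rewrite setTI.
Qed.

Lemma integrable_cylinder f : cylinder f -> mu.-integrable setT (EFin \o f).
Proof.
move=> [k fk]; rewrite (_ : _ \o _ = fun x => (f (extend (block k x)))%:E).
  apply: (integrable_finitely_valued muT (c := block k) _ (f \o @extend S k)).
  exact: block_measurable.
by apply/funext => x; rewrite -depends_belowE.
Qed.

Lemma Rintegral_shift k n f : depends_below k f ->
  \int[mu]_x f (left_shift n x) = \sum_(v : {ffun 'I_k -> S})
    f (extend v) * fine (mu [set x | block k (left_shift n x) = v]).
Proof.
move=> fk; rewrite -(Rintegral_finitely_valued muT (@block_shift_measurable k n)).
by apply: eq_Rintegral => x _; exact: depends_belowE.
Qed.

Lemma Rintegral_block k f : depends_below k f ->
  \int[mu]_x f x = \sum_(v : {ffun 'I_k -> S})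
    f (extend v) * fine (mu [set x | block k x = v]).
Proof.
move=> fk; rewrite -(Rintegral_finitely_valued muT (@block_measurable S k)).
by apply: eq_Rintegral => x _; exact: depends_belowE.
Qed.

End config_integrals.

(** * Law of a block of sites after one step *)

Section kernel_blocks.
Context {R : realType} {S : pfinType}.
Variable P : R.-pker config S ~> config S.
Variable N : nat -> {fset nat}.
Variable p : forall z : nat, {ffun N z -> S} -> S -> R.
Implicit Types (x y w : config S) (k m n z : nat).

(** Conditions (A1) and (A2) over a duplicate-free list of sites and a total configuration [w]:
    disjoint windows then correspond to concatenated lists, over which the product splits. *)
Lemma independent_updates_seq : independent_updates P -> local_updates P p ->
  forall x w (s : seq nat), uniq s ->
  P x [set y | forall z, z \in s -> y z = w z] =
  (\prod_(z <- s) p (restr (N z) x) (w z))%:E.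
Proof.
move=> indP locP x w s us.
have := indP x [fset z in s]%fset (restr _ w).
have -> : [set y | restr [fset z in s]%fset y = restr _ w] =
    [set y | forall z, z \in s -> y z = w z].
  apply/seteqP; split=> y /= => [/ffunP yw z zs|yw].
    have zs' : z \in [fset z in s]%fset by rewrite in_fset.
    by have := yw (FSetSub zs'); rewrite !ffunE.
  by apply/ffunP => z; rewrite !ffunE yw//; have := fsvalP z; rewrite in_fset.
move=> ->; rewrite -prodEFin.
rewrite (eq_bigr (fun z : [fset z in s]%fset =>
    (p (restr (N (fsval z)) x) (w (fsval z)))%:E)) => [|z _].
  rewrite -(big_seq_fsetE _ _ xpredT (fun z => (p (restr (N z) x) (w z))%:E))/=.
  by apply/perm_big/(uniq_perm (fset_uniq _) us) => z; rewrite in_fset.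
by have [_ _ ->] := locP (fsval z); rewrite ffunE.
Qed.

Lemma shifted_block_law : independent_updates P -> local_updates P p ->
  forall x n k (v : {ffun 'I_k -> S}),
  P x [set y | block k (left_shift n y) = v] =
  (\prod_(i < k) p (restr (N (i + n)) x) (v i))%:E.
Proof.
move=> indP locP x n k v.
pose s := [seq (i + n)%N | i <- index_iota 0 k].
have us : uniq s by rewrite map_inj_uniq ?iota_uniq//; exact: addIn.
(* Truncated subtraction is harmless here, every site of [s] being at least [n]. *)
have := independent_updates_seq indP locP x (fun z => extend v (z - n)%N) us.
rewrite big_map big_mkord; under eq_bigr do rewrite addnK extend_ord.
move=> <-; congr (P x _); apply/seteqP; split=> y /=.
  move=> <- z /mapP[i]; rewrite mem_index_iota/= => ik ->.
  by rewrite addnK extend_block.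
move=> yv; apply/ffunP => i; rewrite ffunE /left_shift yv ?addnK ?extend_ord//.
by apply/mapP; exists (val i) => //; rewrite mem_index_iota/=.
Qed.

Lemma block_law : independent_updates P -> local_updates P p ->
  forall x k (v : {ffun 'I_k -> S}),
  P x [set y | block k y = v] = (\prod_(i < k) p (restr (N i) x) (v i))%:E.
Proof.
move=> indP locP x k v; under eq_bigr do rewrite -[nat_of_ord _]addn0.
rewrite -shifted_block_law//.
by congr (P x _); apply/funext => y; rewrite /mkset left_shift0.
Qed.

(** As [m <= n], the windows [[0, m)] and [[n, n + k)] are disjoint, so the product over their union
    splits into two. *)
Lemma joint_block_law : independent_updates P -> local_updates P p ->
  forall x m n k (u : {ffun 'I_m -> S}) (v : {ffun 'I_k -> S}), (m <= n)%N ->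
  P x [set y | block m y = u /\ block k (left_shift n y) = v] =
  (P x [set y | block m y = u] * P x [set y | block k (left_shift n y) = v])%E.
Proof.
move=> indP locP x m n k u v mn.
(* The form [i + 0] lets [addIn] give injectivity for both lists. *)
pose s1 := [seq (i + 0)%N | i <- index_iota 0 m].
pose s2 := [seq (i + n)%N | i <- index_iota 0 k].
have us : uniq (s1 ++ s2).
  rewrite cat_uniq !map_inj_uniq ?iota_uniq//; [|exact: addIn|exact: addIn].
  rewrite /= andbT; apply/hasPn => _ /mapP[i _ ->].
  apply/mapP => -[j]; rewrite mem_index_iota/= addn0 => jm ij.
  by move: jm; rewrite -ij ltnNge (leq_trans mn)// leq_addl.
(* The prescribed configuration glues [u] on the first [m] sites to the translate of [v]. *)
have := independent_updates_seq indP locP x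
  (fun z => if (z < m)%N then extend u z else extend v (z - n)%N) us.
rewrite big_cat !big_map !big_mkord EFinM/=.
under eq_bigr do rewrite addn0 ltn_ord extend_ord.
under [X in _ = (_ * X%:E)%E]eq_bigr do
  rewrite addnK ltnNge (leq_trans mn) ?leq_addl//= extend_ord.
rewrite -(block_law indP locP x u) -(shifted_block_law indP locP x n v) => <-.
congr (P x _); apply/seteqP; split=> y /=.
  move=> [<- <-] z; rewrite mem_cat => /orP[] /mapP[i].
    by rewrite mem_index_iota/= addn0 => im ->; rewrite im extend_block.
  rewrite mem_index_iota/= => ik ->.
  by rewrite ltnNge (leq_trans mn) ?leq_addl//= addnK extend_block.
move=> yv; split; apply/ffunP => i; rewrite ffunE /left_shift yv.
- by rewrite ltn_ord extend_ord.
- rewrite mem_cat; apply/orP; left.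
  by apply/mapP; exists (val i); rewrite ?mem_index_iota/= ?addn0.
- by rewrite ltnNge (leq_trans mn) ?leq_addl//= addnK extend_ord.
- rewrite mem_cat; apply/orP; right.
  by apply/mapP; exists (val i); rewrite ?mem_index_iota/=.
Qed.

(** Moving the window by [n] amounts to moving the starting point: [shift_window] sends the
    restriction of [x] to [N (z + n)] to the restriction of [left_shift n x] to [N z]. *)
Lemma shifted_block_homogeneous : independent_updates P -> local_updates P p ->
  shift_homogeneous p ->
  forall x n k (v : {ffun 'I_k -> S}), (0 < n)%N ->
  P x [set y | block k (left_shift n y) = v] =
  P (left_shift n x) [set y | block k y = v].
Proof.
move=> indP locP [r r0 [HN hom]] x n k v n0.
rewrite (block_law indP locP) (shifted_block_law indP locP).
congr _%:E; apply: eq_bigr => i _; rewrite hom//; congr (p _ _); apply/ffunP => z.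
by rewrite !ffunE.
Qed.

(** By (A6) the update of a site [i < k] reads the sites [i, ..., i + r], all below [k + r]. *)
Lemma block_law_range : independent_updates P -> local_updates P p ->
  shift_homogeneous p -> exists r, forall k (v : {ffun 'I_k -> S}),
  depends_below (k + r) (fun x => P x [set y | block k y = v]).
Proof.
move=> indP locP [r r0 [HN hom]]; exists r => k v x x' xx'.
rewrite !(block_law indP locP); congr _%:E; apply: eq_bigr => i _.
congr (p _ _); apply/ffunP => z; rewrite !ffunE; apply: xx'.
have : fsval z \in iota i r.+1.
  by move: (fsval z) (fsvalP z) => j; rewrite HN in_fset.
rewrite mem_iota => /andP[_].
by rewrite addnS ltnS => /leq_ltn_trans; apply; rewrite ltn_add2r.
Qed.

End kernel_blocks.

(** * One-step expectations of cylinder functions *)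

Section expectation.
Context {R : realType} {S : pfinType}.
Variable P : R.-pker config S ~> config S.
Variable N : nat -> {fset nat}.
Variable p : forall z : nat, {ffun N z -> S} -> S -> R.
Hypotheses (indP : independent_updates P) (locP : local_updates P p)
  (homP : shift_homogeneous p).
Implicit Types (x y : config S) (k m n : nat) (f g h : config S -> R).

(** Both sides are finite sums over pairs of blocks; the joint law factors because the windows are
    disjoint, and homogeneity transfers the shift from [g] to the starting point. *)
Lemma expectation_mul m k n f g x : depends_below m f -> depends_below k g ->
  (m <= n)%N -> (0 < n)%N ->
  \int[P x]_y (f y * g (left_shift n y)) =
  (\int[P x]_y f y) * (\int[P (left_shift n x)]_y g y).
Proof.
move=> fm gk mn n0.
pose c y := (block m y, block k (left_shift n y)).
have mc (B : set ({ffun 'I_m -> S} * {ffun 'I_k -> S})) :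
    measurable (c @^-1` B).
  apply: cylinder_measurable; exists (maxn m (k + n)) => y y' yy'.
  rewrite /preimage/mkset /c; congr (B (_, _)); apply/blockP => i ik.
    by apply: yy'; rewrite leq_max ik.
  by apply: yy'; rewrite leq_max ltn_add2r ik orbT.
rewrite (Rintegral_block (prob_kernel _) fm).
rewrite (Rintegral_block (prob_kernel _) gk).
transitivity (\int[P x]_y (f (extend (c y).1) * g (extend (c y).2))).
  by apply: eq_Rintegral => y _; rewrite /= -!depends_belowE.
rewrite (Rintegral_finitely_valued (prob_kernel _) mc
  (fun u => f (extend u.1) * g (extend u.2))).
rewrite mulr_suml; under [RHS]eq_bigr do rewrite mulr_sumr.
rewrite pair_big/=; apply: eq_bigr => -[u v] _ /=.
rewrite mulrACA; congr (_ * _).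
rewrite -(shifted_block_homogeneous indP locP homP)// -fineM.
- rewrite -(joint_block_law indP locP)//; congr (fine (P x _)).
  by apply/seteqP; split=> y /= [<- <-].
- by rewrite (block_law indP locP).
- by rewrite (shifted_block_law indP locP).
Qed.

Lemma expectation_range : exists r, forall k f, depends_below k f ->
  depends_below (k + r) (fun x => \int[P x]_y f y).
Proof.
have [r Hr] := block_law_range indP locP homP; exists r => k f fk x x' xx'.
rewrite !(Rintegral_block (prob_kernel _) fk); apply: eq_bigr => v _.
by rewrite (Hr _ _ _ _ xx').
Qed.

Lemma cylinder_expectation f :
  cylinder f -> cylinder (fun x => \int[P x]_y f y).
Proof.
have [r Hr] := expectation_range.
by move=> [k fk]; exists (k + r)%N; exact: Hr.
Qed.

(** If the integral vanished, every block would have probability zero, and the integral of the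
    constant 1 would vanish too. *)
Lemma expectation_gt0 f x : cylinder f -> (forall y, 0 < f y) ->
  0 < \int[P x]_y f y.
Proof.
move=> [k fk] f0; rewrite (Rintegral_block (prob_kernel _) fk).
have ge0 (v : {ffun 'I_k -> S}) :
    0 <= f (extend v) * fine (P x [set y | block k y = v]).
  by rewrite mulr_ge0 ?fine_ge0// ltW.
rewrite lt_neqAle sumr_ge0 ?andbT//.
apply/eqP => /esym/(psumr_eq0P (fun v _ => ge0 v)) f_0.
have : \int[P x]_y (cst 1 : config S -> R) y = 1.
  by rewrite Rintegral_cst// prob_kernel mulr1.
have one_k : depends_below k (cst 1 : config S -> R) by [].
rewrite (Rintegral_block (prob_kernel _) one_k) big1 => [/esym/eqP|v _].
  by rewrite oner_eq0.
have /eqP := f_0 v isT.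
by rewrite mulf_eq0 gt_eqF ?f0//= => /eqP ->; rewrite mulr0.
Qed.

End expectation.

(** * Lower bounds drawn from the finiteness of the action *)

Section entropy.
Context {R : realType} {S : pfinType}.
Variable P : R.-pker config S ~> config S.
Variable N : nat -> {fset nat}.
Variable p : forall z : nat, {ffun N z -> S} -> S -> R.
Variable mu : probability (config S) R.
Hypotheses (indP : independent_updates P) (locP : local_updates P p)
  (homP : shift_homogeneous p) (DVmu : (DV_action P mu < +oo)%E).
Implicit Types (x y : config S) (k m n : nat) (f g h : config S -> R).

Let Pf f x := \int[P x]_y f y.

(** The integrand of the action functional at the test function [f]. *)
Let log_ratio f x : R := ln (Pf f x / f x).

Let cylinder_log_ratio f : cylinder f -> cylinder (log_ratio f).
Proof.
move=> cf; apply: (cylinder_op (fun a b => ln (a / b))) => //.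
exact: (cylinder_expectation indP locP homP).
Qed.

(** Positive cylinder functions are admissible in the infimum, which is not [-oo] since the action
    is not [+oo]. *)
Lemma action_bound : exists C, forall f, cylinder f -> (forall x, 0 < f x) ->
  C <= \int[mu]_x log_ratio f x.
Proof.
have [M Mle] : exists M : R, forall f, cylinder f -> (forall x, 0 < f x) ->
    (M%:E <= \int[mu]_x (log_ratio f x)%:E)%E.
  move: DVmu; rewrite /DV_action lteNl/=.
  set A := [set _ | _ in _].
  have inA f : cylinder f -> (forall x, 0 < f x) ->
      A (\int[mu]_x (log_ratio f x)%:E)%E.
    by move=> cf f0; exists f => //; split => //; exact: cylinder_continuous.
  case E : (ereal_inf A) => [M| |//] _.
    exists M => f cf f0; rewrite -E; apply: ereal_inf_lbound; exact: inA.
  (* If the infimum were [+oo], all the integrals would be [+oo] and any constant would do. *)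
  exists 0 => f cf f0.
  have := ereal_inf_lbound (inA f cf f0).
  by rewrite E leye_eq => /eqP ->; rewrite leey.
exists M => f cf f0; have := Mle f cf f0.
have /integrable_fin_num : mu.-integrable setT (EFin \o log_ratio f).
  apply: integrable_cylinder; first exact: probability_setT.
  exact: cylinder_log_ratio.
rewrite /Rintegral => fin Mf; rewrite -lee_fin fineK//; exact: fin.
Qed.

Lemma log_ratio_mul m k n f h x : depends_below m f -> depends_below k h ->
  (forall y, 0 < f y) -> (forall y, 0 < h y) -> (m <= n)%N -> (0 < n)%N ->
  log_ratio (fun y => f y * h (left_shift n y)) x =
  log_ratio f x + log_ratio h (left_shift n x).
Proof.
move=> fm hk f0 h0 mn n0.
rewrite /log_ratio /Pf (expectation_mul indP locP homP x fm hk mn n0).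
have Pf0 := expectation_gt0 P x (ex_intro _ m fm) f0.
have Ph0 := expectation_gt0 P (left_shift n x) (ex_intro _ k hk) h0.
rewrite -lnM ?posrE ?divr_gt0//; congr ln.
by rewrite invfM mulrACA.
Qed.

(** Otherwise there are shifts, as large as desired, with integral below [- e]; the product of [J]
    sufficiently separated translates of [h] has integral at most [- J e], against
    [action_bound]. *)
Lemma log_ratio_shift_liminf h e : cylinder h -> (forall y, 0 < h y) -> 0 < e ->
  \forall n \near \oo, - e <= \int[mu]_x log_ratio h (left_shift n x).
Proof.
move=> [k hk] h0 e0; have [C HC] := action_bound.
apply: contrapT => notnear.
have often m : exists2 n, (m < n)%N &
    \int[mu]_x log_ratio h (left_shift n x) < - e.
  apply: contrapT => no; apply: notnear; exists m.+1 => // n /= mn.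
  by rewrite leNgt; apply/negP => ?; apply: no; exists n.
have step J : exists f, [/\ cylinder f, forall x, 0 < f x &
    \int[mu]_x log_ratio f x <= - (J%:R * e)].
  elim: J => [|J [f [[m fm] f0 fJ]]].
    exists (cst 1); split=> [|x|].
    - by exists 0%N.
    - by rewrite ltr01.
    rewrite mul0r oppr0 (_ : log_ratio _ = cst 0) ?Rintegral_cst ?mul0r//.
    apply/funext => x; rewrite /log_ratio /Pf Rintegral_cst//= prob_kernel.
    by rewrite mul1r divr1 ln1.
  (* Taking [n] beyond the window [m] of the product built so far makes the new factor depend on
     other sites. *)
  have [n mn hn] := often m.
  have n0 : (0 < n)%N by exact: leq_ltn_trans mn.
  exists (fun x => f x * h (left_shift n x)); split.
  - apply: (cylinder_op *%R); first by exists m.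
    by apply: cylinder_shift; exists k.
  - by move=> x; rewrite mulr_gt0.
  rewrite (_ : \int[mu]_x _ =
      \int[mu]_x (log_ratio f x + log_ratio h (left_shift n x))); last first.
    apply: eq_Rintegral => x _.
    by apply: (log_ratio_mul _ fm hk) => //; exact: ltnW.
  rewrite RintegralD//; last 2 first.
  - apply: integrable_cylinder; first exact: probability_setT.
    by apply: cylinder_log_ratio; exists m.
  - apply: (@integrable_cylinder _ _ mu _ (log_ratio h \o left_shift n)).
      exact: probability_setT.
    by apply/cylinder_shift/cylinder_log_ratio; exists k.
  by rewrite -natr1 mulrDl mul1r opprD lerD// ltW.
(* The Archimedean property, applied to the ratio of the absolute value of [C] to [e]. *)
have [J HJ] : exists J : nat, - C < J%:R * e.
  exists (Num.bound (`|C| / e)); rewrite -ltr_pdivrMr//.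
  apply: le_lt_trans (archi_boundP _); last by rewrite divr_ge0// ltW.
  by rewrite ler_pM2r ?invr_gt0// -normrN ler_norm.
have [f [cf f0 fJ]] := step J.
have := le_trans (HC f cf f0) fJ.
by rewrite lerNr leNgt HJ.
Qed.

End entropy.

(** * Linearization of the logarithm and asymptotic invariance *)

Lemma ln_ratio_perturbation (R : realType) (e a b : R) :
  0 < e <= 2^-1 -> `|a| <= 1 -> `|b| <= 1 ->
  ln ((1 + e * a) / (1 + e * b)) <= e * (a - b) + 4 * e ^+ 2.
Proof.
move=> /andP[e0 e2]; rewrite !ler_norml => /andP[a1 a2] /andP[b1 b2].
have hb : 2^-1 <= 1 + e * b by nra.
have ha : 2^-1 <= 1 + e * a by nra.
have hb0 : 0 < 1 + e * b by lra.
have ha0 : 0 < 1 + e * a by lra.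
(* The ratio is put in the form [1 + t] in order to use [ln (1 + t) <= t]. *)
have -> : (1 + e * a) / (1 + e * b) = 1 + e * (a - b) / (1 + e * b).
  by field; rewrite gt_eqF.
apply: (le_trans (le_ln1Dx _)).
  by rewrite ltr_pdivlMr//; nra.
rewrite ler_pdivrMr//.
(* Removing the denominator costs at most [2 * e ^+ 2] divided by [1 + e * b >= 2^-1], whence the
   constant 4. *)
suff : - 2 * e ^+ 2 <= e ^+ 2 * (b * (a - b)) by nra.
suff : -2 <= b * (a - b) by have := sqr_ge0 e; nra.
nra.
Qed.

Section asymptotic_invariance.
Context {R : realType} {S : pfinType}.
Variable P : R.-pker config S ~> config S.
Variable N : nat -> {fset nat}.
Variable p : forall z : nat, {ffun N z -> S} -> S -> R.
Variable mu : probability (config S) R.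
Hypotheses (indP : independent_updates P) (locP : local_updates P p)
  (homP : shift_homogeneous p) (DVmu : (DV_action P mu < +oo)%E).
Implicit Types (x y : config S) (k m n : nat) (f g h : config S -> R).

Let drift g n := \int[mu]_x
  (\int[P (left_shift n x)]_y g y - g (left_shift n x)).

Let drift_liminf g d : cylinder g -> (forall x, `|g x| <= 1) -> 0 < d ->
  \forall n \near \oo, - d <= drift g n.
Proof.
(* The estimates below combine into [- e ^+ 2 <= e * drift g n + 4 * e ^+ 2], so that
   [drift g n >= - 5 * e]: hence [d / 5]. The bound [2^-1] is the one asked by
   [ln_ratio_perturbation]. *)
move=> cg g1 d0; pose e := Num.min 2^-1 (d / 5).
have e0 : 0 < e by rewrite lt_min invr_gt0 ltr0n divr_gt0.
have e2 : e <= 2^-1 by rewrite ge_min lexx.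
have ed : 5 * e <= d by rewrite mulrC -ler_pdivlMr// ge_min lexx orbT.
have ig x : (P x).-integrable setT (EFin \o g).
  by apply: integrable_cylinder => //; exact: prob_kernel.
have i1 x (c : R) : (P x).-integrable setT (EFin \o cst c).
  by apply: integrable_cylinder; [exact: prob_kernel|exists 0%N].
have Pcst x (c : R) : \int[P x]_y (cst c : config S -> R) y = c.
  by rewrite Rintegral_cst// prob_kernel mulr1.
have Pg1 x : `|\int[P x]_y g y| <= 1.
  rewrite ler_norml; apply/andP; split.
    rewrite -(Pcst x (- 1)); apply: le_Rintegral => // y _ /=.
    by have := g1 y; rewrite ler_norml => /andP[].
  rewrite -[leRHS](Pcst x 1); apply: le_Rintegral => // y _ /=.
  by have := g1 y; rewrite ler_norml => /andP[].
pose h x := 1 + e * g x.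
have ch : cylinder h by exact: (cylinder_comp (fun t => 1 + e * t)).
have h0 x : 0 < h x.
  by have := g1 x; rewrite ler_norml => /andP[]; rewrite /h; nra.
have Ph x : \int[P x]_y h y = 1 + e * \int[P x]_y g y.
  rewrite RintegralD//; [|exact: i1|].
    by rewrite Pcst RintegralZl.
  apply: (@integrable_cylinder _ _ (P x) _ (fun y => e * g y)).
    exact: prob_kernel.
  exact: (cylinder_comp (fun t => e * t)).
have e20 : 0 < e ^+ 2 by rewrite exprn_gt0.
(* The tolerance [e ^+ 2] has the order of the linearization error. *)
apply: filterS (log_ratio_shift_liminf indP locP homP DVmu ch h0 e20) => n le.
pose D x := \int[P x]_y g y - g x.
have cD : cylinder D.
  by apply: (cylinder_op (fun a b => a - b)) => //; exact: cylinder_expectation.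
have iD c c' : mu.-integrable setT
    (EFin \o (fun x => c * D (left_shift n x) + c')).
  apply: integrable_cylinder; first exact: probability_setT.
  exact: (cylinder_comp (fun t => c * t + c') (cylinder_shift n cD)).
have : \int[mu]_x ln ((\int[P (left_shift n x)]_y h y) / h (left_shift n x)) <=
    \int[mu]_x (e * D (left_shift n x) + 4 * e ^+ 2).
  apply: le_Rintegral => //.
    apply: integrable_cylinder; first exact: probability_setT.
    apply: (@cylinder_shift _ _ n (fun x => ln ((\int[P x]_y h y) / h x))).
    apply: (cylinder_op (fun a b => ln (a / b))) => //.
    exact: (cylinder_expectation indP locP homP).
  move=> x _; rewrite Ph; apply: ln_ratio_perturbation => //.
  by rewrite e0.
rewrite RintegralD//; last 2 first.
- by have := iD e 0; under eq_fun do rewrite addr0.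
- by have := iD 0 (4 * e ^+ 2); under eq_fun do rewrite mul0r add0r.
rewrite RintegralZl//; last first.
  by have := iD 1 0; under eq_fun do rewrite mul1r addr0.
rewrite (Rintegral_const _ (probability_setT mu)) -/(drift g n) => /(le_trans le) H.
by rewrite -(ler_pM2l e0); apply: le_trans (_ : - (5 * e ^+ 2) <= _); nra.
Qed.

(** The lower bound [drift_liminf], applied to [g] and to its opposite, bounds the drift on both
    sides. *)
Lemma asymptotically_invariant g : cylinder g -> (forall x, `|g x| <= 1) ->
  drift g n @[n --> \oo] --> 0.
Proof.
move=> cg g1; have cNg : cylinder (\- g) by exact: (cylinder_comp -%R).
have driftN n : drift (\- g) n = - drift g n.
  rewrite /drift -[RHS]mulN1r -RintegralZl//; last first.
    apply: integrable_cylinder; first exact: probability_setT.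
    apply: (@cylinder_shift _ _ n (fun x => \int[P x]_y g y - g x)).
    apply: (cylinder_op (fun a b => a - b)) => //.
    exact: (cylinder_expectation indP locP homP).
  apply: eq_Rintegral => x _ /=; rewrite mulN1r opprB opprK addrC; congr (_ + _).
  rewrite -mulN1r -RintegralZl//.
    by apply: eq_Rintegral => y _; rewrite mulN1r.
  by apply: integrable_cylinder => //; exact: prob_kernel.
apply/cvgrPdist_le => d d0; near=> n.
rewrite sub0r normrN ler_norml -[drift g n <= d]lerN2 -driftN.
apply/andP; split; near: n; apply: drift_liminf => //.
by move=> x; rewrite normrN.
Unshelve. all: by end_near. Qed.

End asymptotic_invariance.

(** * The algebra of cylinder sets *)

Definition cylinder_space (S : pfinType) : Type := config S.

Section cylinder_algebra.
Context {S : pfinType}.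
Implicit Types A B : set (config S).

Lemma cylinder_cst T (a : T) : cylinder (fun _ : config S => a).
Proof. by exists 0%N. Qed.

Lemma cylinder_setU A B : cylinder A -> cylinder B -> cylinder (A `|` B).
Proof. by move=> cA cB; exact: (cylinder_op (fun a b : Prop => a \/ b)). Qed.

Lemma cylinder_setI A B : cylinder A -> cylinder B -> cylinder (A `&` B).
Proof. by move=> cA cB; exact: (cylinder_op (fun a b : Prop => a /\ b)). Qed.

Lemma cylinder_setC A : cylinder A -> cylinder (~` A).
Proof. by move=> cA; exact: (cylinder_comp not). Qed.

(** On the alias [cylinder_space] the measurable sets are the cylinder sets, whereas [config] keeps
    its Borel sets. *)
HB.instance Definition _ := Pointed.on (cylinder_space S).
HB.instance Definition _ := @isAlgebraOfSets.Build default_measure_display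
  (cylinder_space S) (@cylinder S Prop) (cylinder_cst False)
  cylinder_setU cylinder_setC.

Lemma cylinder_bigsetU (F : nat -> set (config S)) n :
  (forall i, cylinder (F i)) -> cylinder (\big[setU/set0]_(i < n) F i).
Proof.
move=> cF; elim/big_ind : _ => //; first exact: cylinder_cst.
exact: cylinder_setU.
Qed.

(** An open set is the countable union over [k] of the cylinder sets formed by the points whose
    block of length [k] already forces membership. *)
Lemma open_sigma_cylinder A : open A -> <<s @cylinder S Prop >> A.
Proof.
move=> oA; have -> : A = \bigcup_k
    [set x | [set y | block k y = block k x] `<=` A].
  apply/seteqP; split=> [x Ax|x [k _]]; last by apply.
  have /nbhs_blockP[k kA] : nbhs x A by exact: open_nbhs_nbhs.
  by exists k.
apply: sigma_algebra_bigcup => k; apply: sub_sigma_algebra; exists k.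
by move=> x y /blockP xy; rewrite /mkset xy.
Qed.

Lemma measurable_sigma_cylinder A : measurable A -> <<s @cylinder S Prop >> A.
Proof.
apply: smallest_sub; first exact: smallest_sigma_algebra.
exact: open_sigma_cylinder.
Qed.

(** Cylinder sets are open and closed; if the union is one, it is compact and finitely many [F i]
    cover it. *)
Lemma cylinder_bigcup_finite (F : nat -> set (config S)) :
  (forall i, cylinder (F i)) -> cylinder (\bigcup_i F i) ->
  \forall n \near \oo, \bigcup_i F i = \big[setU/set0]_(i < n) F i.
Proof.
move=> cF cU.
have : near_covering [set: config S].
  exact/compact_near_coveringP/config_compact.
move=> /(_ nat \oo (fun n x =>
  (\bigcup_i F i) x -> exists2 i, (i < n)%N & F i x)).
case=> [x _|n0 _ Hn0].
  have [[i _ Fix]|nUx] := pselect ((\bigcup_i F i) x).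
    exists (F i, [set n | (i < n)%N]) => /=.
      split; last by exists i.+1.
      by apply: open_nbhs_nbhs; split => //; exact: cylinder_open.
    by move=> [y n] [/= Fiy ltin] _; exists i.
  (* Outside the union, the open complement is a neighbourhood on which nothing has to be
     covered. *)
  exists (~` \bigcup_i F i, setT) => /=; last by move=> [y n] [].
  split; last exact: filterT.
  by apply: open_nbhs_nbhs; split => //; exact/cylinder_open/cylinder_setC.
exists n0 => // n /Hn0 H; apply/seteqP; split=> x.
  by move=> /(H x I)[i ltin Fix]; rewrite -bigcup_mkord; exists i.
by rewrite -bigcup_mkord => -[i _ Fix]; exists i.
Qed.

End cylinder_algebra.

(** * Extension of a content on cylinder sets to a Borel probability *)

Section cylinder_extension.
Context {R : realType} {S : pfinType}.
Variable l : set (config S) -> R.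
Hypotheses (l_ge0 : forall A, cylinder A -> 0 <= l A) (l0 : l set0 = 0)
  (lT : l setT = 1)
  (lU : forall A B, cylinder A -> cylinder B -> A `&` B = set0 ->
     l (A `|` B) = l A + l B).

(* A set function must be nonnegative on all sets to be a measure in the
   library, whence the absolute value. *)
Let content (A : set (cylinder_space S)) : \bar R := `|l A|%:E.

Let contentE A : cylinder A -> content A = (l A)%:E.
Proof. by move=> cA; rewrite /content ger0_norm ?l_ge0. Qed.

Let content0 : content set0 = 0%E.
Proof. by rewrite /content l0 normr0. Qed.

Let content_ge0 A : (0 <= content A)%E.
Proof. by rewrite lee_fin. Qed.

(** By [cylinder_bigcup_finite] the union equals all late finite unions, so the partial sums are
    eventually constant and finite additivity is enough. *)
Let content_sigma_additive : semi_sigma_additive content.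
Proof.
move=> F mF tF mUF; apply: cvg_near_cst.
apply: filterS (cylinder_bigcup_finite mF mUF) => n ->.
rewrite big_mkord; elim: n => [|n IH]; first by rewrite !big_ord0 content0.
have cU : cylinder (\big[setU/set0]_(i < n) F i) by exact: cylinder_bigsetU.
have cFn : cylinder (F n) by exact: mF.
rewrite !big_ord_recr/= IH (contentE cU) (contentE cFn).
rewrite contentE ?lU//; last exact: cylinder_setU.
by apply: (@trivIset_bigsetUI _ xpredT) => //; apply: sub_trivIset tF.
Qed.

HB.instance Definition _ := isMeasure.Build _ (cylinder_space S) R content
  content0 content_ge0 content_sigma_additive.

(** The Caratheodory extension lives on the sigma-algebra generated by the cylinder sets; as this
    contains the Borel sets, it can be read as a measure on [config S]. *)
Let extension (A : set (config S)) : \bar R := measure_extension content A.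

Let extension0 : extension set0 = 0%E.
Proof. exact: (@measure0 _ _ _ (measure_extension content)). Qed.

Let extension_ge0 A : (0 <= extension A)%E.
Proof. exact: (@measure_ge0 _ _ _ (measure_extension content)). Qed.

Let extension_sigma_additive : semi_sigma_additive extension.
Proof.
move=> F mF tF mUF.
apply: (@measure_semi_sigma_additive _ _ _ (measure_extension content)) => //.
  by move=> i; exact: measurable_sigma_cylinder.
exact: measurable_sigma_cylinder.
Qed.

HB.instance Definition _ := isMeasure.Build _ (config S) R extension
  extension0 extension_ge0 extension_sigma_additive.

Let extensionE A : cylinder A -> extension A = (l A)%:E.
Proof.
move=> cA; rewrite /extension /measure_extension measurable_mu_extE//.
exact: contentE.
Qed.

Let extensionT : extension setT = 1%E.
Proof. by rewrite extensionE ?lT//; exact: cylinder_cst. Qed.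

HB.instance Definition _ := Measure_isProbability.Build _ (config S) R extension
  extensionT.

Lemma cylinder_extension : exists nu : probability (config S) R,
  forall A, cylinder A -> nu A = (l A)%:E.
Proof. by exists extension. Qed.

End cylinder_extension.

(** * Convergence along ultrafilters *)

Lemma ultra_bounded_cvg (R : realType) (T : Type) (U : set_system T)
    (u : T -> R) : UltraFilter U -> (forall t, 0 <= u t <= 1) ->
  cvg (u t @[t --> U]).
Proof.
move=> UU u01.
have [l [_ ul]] : [set` `[0 : R, 1]] `&` cluster (u t @[t --> U]) !=set0.
  apply: (@segment_compact R 0 1).
  suff : U (u @^-1` [set` `[0, 1]]) by [].
  by apply: filterS filterT => t _ /=; rewrite in_itv/= u01.
apply/cvg_ex; exists l => V lV.
(* An ultrafilter converges to each of its cluster points: the complement of a neighbourhood [V] of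
   [l] cannot be charged. *)
have [//|UnV] := in_ultra_setVsetC (u @^-1` V) UU.
by have [t []] := ul (~` V) V UnV lV.
Qed.

Lemma cvg_ultra (T : Type) (X : topologicalType) (F : set_system T)
    (u : T -> X) (l : X) : Filter F ->
  (forall U, UltraFilter U -> F `<=` U -> u t @[t --> U] --> l) ->
  u t @[t --> F] --> l.
Proof.
move=> FF ultra V lV; apply: contrapT => nFV.
(* If [F] does not charge the preimage of [V], its trace [G] on the complement is proper; an
   ultrafilter finer than [G] is finer than [F], yet [u] avoids [V] along it. *)
pose G := within (~` (u @^-1` V)) F.
have PG : ProperFilter G.
  apply: Build_ProperFilter_ex => A GA; apply: contrapT => nA; apply: nFV.
  have {}GA : F [set t | (~` (u @^-1` V)) t -> A t] by exact: GA.
  suff : F (u @^-1` V) by [].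
  apply: filterS GA => t At; apply: contrapT => nVt.
  by apply: nA; exists t; exact: At.
have [U [UU GU]] := ultraFilterLemma PG.
have FU : F `<=` U.
  move=> A FA; apply: GU.
  suff : F [set t | (~` (u @^-1` V)) t -> A t] by [].
  by apply: filterS FA => t At _.
have UV : U (u @^-1` V) by exact: ultra lV.
have UnV : U (~` (u @^-1` V)) by apply: GU; exact: withinT.
by have [t [? ?]] := filter_ex (filterI UV UnV).
Qed.

(** * Invariance tested on cylinder sets *)

Section invariance_on_cylinders.
Context {R : realType} {S : pfinType}.
Variables (P : R.-pker config S ~> config S) (nu : probability (config S) R).

(** The law after one step started from [nu], made into a measure so that uniqueness of measures
    applies. *)
Let next (A : set (config S)) : \bar R := (\int[nu]_x P x A)%E.

Let next0 : next set0 = 0%E.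
Proof.
by rewrite /next; under eq_integral do rewrite measure0; rewrite integral0.
Qed.

Let next_ge0 A : (0 <= next A)%E.
Proof. by apply: integral_ge0 => x _; exact: measure_ge0. Qed.

Let next_sigma_additive : semi_sigma_additive next.
Proof.
move=> F mF tF mUF; rewrite /next.
rewrite (_ : (\int[nu]_x P x (\bigcup_n F n))%E =
             (\sum_(0 <= n <oo) \int[nu]_x P x (F n))%E).
  by apply: is_cvg_nneseries => n _ _; exact: next_ge0.
rewrite -(integral_nneseries nu measurableT (f := fun n x => P x (F n)))//.
  apply: eq_integral => x _; rewrite measure_bigcup//.
  by apply: eq_eseriesl => n; rewrite in_setT.
by move=> n; exact: measurable_kernel.
Qed.

HB.instance Definition _ := isMeasure.Build _ (config S) R next
  next0 next_ge0 next_sigma_additive.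

(** Cylinder sets are stable under intersection and generate the Borel sets, so two finite measures
    agreeing on them agree. *)
Lemma time_invariant_cylinder :
  (forall A, cylinder A -> \int[nu]_x P x A = nu A)%E -> time_invariant P nu.
Proof.
move=> cA A; apply: (@measure_unique _ R (config S) (@cylinder S Prop)
  (fun=> setT) _ _ _ _ next nu).
- apply/seteqP; split; first exact: measurable_sigma_cylinder.
  apply: smallest_sub; first exact: sigma_algebra_measurable.
  exact: cylinder_measurable.
- exact: cylinder_setI.
- by move=> _; exact: cylinder_cst.
- by rewrite bigcup_const//; exists 0%N.
- exact: cA.
- move=> _; change (next setT < +oo)%E.
  suff -> : next setT = 1%E by rewrite ltry.
  by rewrite -(probability_setT nu); exact/cA/cylinder_cst.
Qed.

End invariance_on_cylinders.

(** * Limit points of the shifted measures *)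

Section limit_points.
Context {R : realType} {S : pfinType}.
Variable P : R.-pker config S ~> config S.
Variable N : nat -> {fset nat}.
Variable p : forall z : nat, {ffun N z -> S} -> S -> R.
Variable mu : probability (config S) R.
Hypotheses (indP : independent_updates P) (locP : local_updates P p)
  (homP : shift_homogeneous p) (DVmu : (DV_action P mu < +oo)%E).
Implicit Types (A B : set (config S)) (f g : config S -> R).

(** Index [n] stands for the shift by [n + 1], the sequence starting at shift 1. *)
Let shift_prob A n : R := fine (mu (left_shift n.+1 @^-1` A)).

Let measurable_shift A n : cylinder A -> measurable (left_shift n @^-1` A).
Proof.
move=> cA; apply: cylinder_measurable.
exact: (@cylinder_shift S Prop n A).
Qed.

(** The integral of a cylinder function is a fixed finite linear combination of probabilities of
    cylinder sets. *)
Lemma cvg_Rintegral_shift (U : set_system nat) (nu : probability (config S) R) :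
  Filter U ->
  (forall A, cylinder A -> shift_prob A n @[n --> U] --> fine (nu A)) ->
  forall f, cylinder f ->
  \int[mu]_x f (left_shift n.+1 x) @[n --> U] --> \int[nu]_x f x.
Proof.
move=> FU cvgU f [k fk].
rewrite (Rintegral_block (probability_setT nu) fk).
under eq_fun do rewrite (Rintegral_shift (probability_setT mu) _ fk).
apply: cvg_big => [|v _]; first exact: add_continuous.
apply: cvgM; first exact: cvg_cst.
apply: (cvgU [set x | block k x = v]).
by exists k => x y /blockP xy; rewrite /mkset xy.
Qed.

(** For the indicator [g] of a cylinder set, the drift tends to 0 and also, along [U], to the
    integral of [Pg - g] against [nu]. *)
Lemma limit_time_invariant (U : set_system nat) (nu : probability (config S) R) :
  ProperFilter U -> \oo `<=` U ->
  (forall A, cylinder A -> shift_prob A n @[n --> U] --> fine (nu A)) ->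
  time_invariant P nu.
Proof.
move=> FU ooU cvgU; apply: time_invariant_cylinder => A cA.
have mA : measurable A by exact: cylinder_measurable.
pose g x : R := \1_A x.
have cg : cylinder g by exact: (cylinder_comp (fun a : Prop => (asbool a)%:R) cA).
pose Pg x := \int[P x]_y g y.
have cPg : cylinder Pg by exact: (cylinder_expectation indP locP homP).
have PgE x : P x A = (Pg x)%:E.
  rewrite /Pg /Rintegral /g integral_indic// setIT fineK//.
  exact: fin_num_mass1 (prob_kernel _) mA.
have nuA : nu A = (\int[nu]_x g x)%:E.
  rewrite /Rintegral /g integral_indic// setIT fineK//.
  exact: fin_num_measure.
have int_cyl (m : probability (config S) R) f : cylinder f ->
    m.-integrable setT (EFin \o f).
  by apply: integrable_cylinder; exact: probability_setT.
rewrite nuA (eq_integral (fun x => (Pg x)%:E)) => [|x _]; last exact: PgE.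
have -> : (\int[nu]_x (Pg x)%:E = (\int[nu]_x Pg x)%:E)%E.
  by rewrite /Rintegral fineK//; exact/integrable_fin_num/int_cyl.
congr EFin; apply/eqP; rewrite -subr_eq0; apply/eqP.
have lim : \int[mu]_x Pg (left_shift n.+1 x) - \int[mu]_x g (left_shift n.+1 x)
    @[n --> U] --> \int[nu]_x Pg x - \int[nu]_x g x.
  by apply: cvgB; apply: cvg_Rintegral_shift.
apply: (cvg_unique (@norm_hausdorff _ R) lim).
have g1 x : `|g x| <= 1.
  by rewrite /g indicE; case: (_ \in _); rewrite ?normr1 ?normr0.
have := asymptotically_invariant indP locP homP DVmu cg g1.
(* Dropping the first term aligns the index with [n.+1]; convergence then passes to the finer filter
   [U]. *)
rewrite -cvg_shiftS => /(cvg_trans (cvg_app _ ooU)) drift0.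
apply: cvg_trans drift0; apply: near_eq_cvg; apply: nearW => n /=.
rewrite RintegralB//.
  exact/int_cyl/(cylinder_shift n.+1 cPg).
exact/int_cyl/(cylinder_shift n.+1 cg).
Qed.

Lemma cvg_shift_prob (nuTI : probability (config S) R) :
  unique_time_invariant P nuTI ->
  forall A, cylinder A -> shift_prob A n @[n --> \oo] --> fine (nuTI A).
Proof.
move=> [_ uniqTI] A cA; apply: cvg_ultra => U UU ooU.
have fin_mu B n : cylinder B -> mu (left_shift n.+1 @^-1` B) \is a fin_num.
  by move=> cB; apply: fin_num_measure; exact: measurable_shift.
(* This limit is controlled on cylinder sets only, as [cylinder_extension] requires. *)
pose l B := lim (shift_prob B n @[n --> U]).
have cvgl B : cylinder B -> shift_prob B n @[n --> U] --> l B.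
  move=> cB; apply: ultra_bounded_cvg => n.
  rewrite /shift_prob fine_ge0//= -lee_fin fineK ?fin_mu//.
  by apply: probability_le1; exact: measurable_shift.
have [||||nu nuE] := @cylinder_extension R S l.
- move=> B cB; apply: (limr_ge (cvgl B cB)).
  by apply: nearW => n; rewrite /shift_prob fine_ge0.
- apply: (cvg_lim (@norm_hausdorff _ R)).
  rewrite (_ : shift_prob set0 = cst 0); first exact: cvg_cst.
  by apply/funext => n; rewrite /shift_prob preimage_set0 measure0.
- apply: (cvg_lim (@norm_hausdorff _ R)).
  rewrite (_ : shift_prob setT = cst 1); first exact: cvg_cst.
  by apply/funext => n; rewrite /shift_prob preimage_setT probability_setT.
- move=> B C cB cC BC0; apply: (cvg_lim (@norm_hausdorff _ R)).
  rewrite (_ : shift_prob (B `|` C) = shift_prob B \+ shift_prob C).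
    by apply: cvgD; exact: cvgl.
  apply/funext => n; rewrite /shift_prob preimage_setU measureU ?fineD ?fin_mu//.
  - exact: measurable_shift.
  - exact: measurable_shift.
  - by rewrite -preimage_setI BC0 preimage_set0.
have nulim B : cylinder B -> shift_prob B n @[n --> U] --> fine (nu B).
  by move=> cB; rewrite nuE//=; exact: cvgl.
rewrite -(uniqTI nu); first exact: nulim.
- exact: limit_time_invariant nulim.
- exact: cylinder_measurable.
Qed.

(** * From cylinder functions to continuous functions *)

Lemma Rintegral_dist_le (m : probability (config S) R) f g e :
  m.-integrable setT (EFin \o f) -> m.-integrable setT (EFin \o g) ->
  (forall x, `|f x - g x| <= e) ->
  `|\int[m]_x f x - \int[m]_x g x| <= e.
Proof.
move=> fi gi fge; rewrite -RintegralB//.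
have ifg : m.-integrable setT (EFin \o (f \- g)).
  exact: (integrableB measurableT fi gi).
apply: (le_trans (le_normr_Rintegral _ _)) => //.
rewrite -[leRHS](Rintegral_const e (probability_setT m)).
apply: le_Rintegral => //.
- exact: (integrable_norm ifg).
- apply: (@integrable_cylinder _ _ _ _ (cst e)); first exact: probability_setT.
  exact: cylinder_cst.
Qed.

(** Compactness gives one [k] for which resetting the sites from [k] on changes [f] by at most [e]
    everywhere. *)
Lemma continuous_cylinder_approx f e : continuous f -> 0 < e ->
  exists2 g, cylinder g & forall x, `|f x - g x| <= e.
Proof.
move=> cf e0.
have : near_covering [set: config S].
  exact/compact_near_coveringP/config_compact.
move=> /(_ nat \oo
  (fun k x => `|f x - f (extend (block k x))| <= e)).
case=> [x _|k _ Hk]; last first.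
  exists (fun x => f (extend (block k x))).
    by exists k => x y /blockP ->.
  by move=> x; apply: Hk => /=.
have e20 : 0 < e / 2 by rewrite divr_gt0.
have /cvgrPdist_le/(_ _ e20)/nbhs_blockP[k0 Hk0] := cf x.
exists ([set y | block k0 y = block k0 x], [set k | (k0 <= k)%N]) => /=.
  by split; [exact: nbhs_block|exists k0].
move=> [y k] [/= yx k0k].
have h1 := Hk0 _ yx.
(* Both [y] and its truncation lie in the block cylinder of [x], where [f] is within [e / 2] of
   [f x]. *)
have /Hk0 h2 : block k0 (extend (block k y)) = block k0 x.
  rewrite -yx; apply/blockP => i ik0; apply: extend_block.
  exact: leq_trans k0k.
have -> : f y - f (extend (block k y)) =
    (f x - f (extend (block k y))) - (f x - f y) by ring.
by rewrite (le_trans (ler_normB _ _))// (splitr e) lerD.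
Qed.

Lemma integrable_continuous (m : probability (config S) R) f :
  continuous f -> m.-integrable setT (EFin \o f).
Proof.
move=> cf.
have [g [k gk] fg] := continuous_cylinder_approx cf ltr01.
apply: measurable_bounded_integrable => //.
- by rewrite -ge0_fin_numE//; exact: fin_num_measure.
- apply: (measurability _ (measurable_realfun.RGenOInfty.measurableE R)).
  move=> _ [_ [a ->] <-].
  rewrite setTI; apply: sub_sigma_algebra.
  by move/continuousP: cf; apply; exact: interval_open.
(* The function [f] is within 1 of [g], and the sum dominates each of the finitely many values of
   [g]. *)
exists (1 + \sum_(v : {ffun 'I_k -> S}) `|g (extend v)|).
split; first by rewrite num_real.
move=> M ltM x _ /=; apply: le_trans (ltW ltM).
rewrite -[f x](subrK (g x)) (le_trans (ler_normD _ _))// lerD//.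
by rewrite (depends_belowE _ gk) (bigD1 (block k x))//= lerDl sumr_ge0.
Qed.

Lemma weak_cvg_shift (nuTI : probability (config S) R) :
  unique_time_invariant P nuTI ->
  weak_cvg (fun n => distribution mu (left_shift n.+1)) nuTI.
Proof.
move=> uniqTI f cf _; apply/cvgrPdist_le => e e0.
(* Two thirds pay for replacing [f] by [g] under the two measures, the last one for the convergence
   on [g]. *)
have e30 : 0 < e / 3 by rewrite divr_gt0.
have [g cg fg] := continuous_cylinder_approx cf e30.
have lim_g := cvg_Rintegral_shift eventually_filter (cvg_shift_prob uniqTI) cg.
have /cvgrPdist_le/(_ _ e30) := lim_g.
apply: filterS => n gn.
have cfn : continuous (f \o left_shift n.+1).
  move=> x; apply: continuous_comp; [exact: left_shift_continuous|exact: cf].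
have int_cyl (m : probability (config S) R) h : cylinder h ->
    m.-integrable setT (EFin \o h).
  by apply: integrable_cylinder; exact: probability_setT.
have -> : \int[distribution mu (left_shift n.+1)]_x f x =
    \int[mu]_x f (left_shift n.+1 x).
  rewrite /Rintegral integral_distribution//.
    exact: (measurable_int _ (integrable_continuous nuTI cf)).
  exact: (integrable_continuous mu cfn).
have H1 : `|\int[nuTI]_x f x - \int[nuTI]_x g x| <= e / 3.
  apply: Rintegral_dist_le => //; first exact: integrable_continuous.
  exact: int_cyl.
have H2 : `|\int[mu]_x f (left_shift n.+1 x) -
    \int[mu]_x g (left_shift n.+1 x)| <= e / 3.
  apply: (Rintegral_dist_le (f := f \o left_shift n.+1)) => //.
  - exact: integrable_continuous.
  - exact/int_cyl/(cylinder_shift n.+1 cg).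
  - by move=> x; exact: fg.
move: gn H1 H2; rewrite !ler_norml => /andP[? ?] /andP[? ?] /andP[? ?].
by apply/andP; split; lra.
Qed.

End limit_points.

Unset Implicit Arguments.

Theorem theorem3 (R : realType) (S : pfinType)
    (P : R.-pker config S ~> config S)
    (N : nat -> {fset nat}) (p : forall z : nat, {ffun N z -> S} -> S -> R)
    (nuTI mu : probability (config S) R) :
  independent_updates P ->
  local_updates P p ->
  positive_rates p ->
  finite_influence N ->
  shift_homogeneous p ->
  unique_time_invariant P nuTI ->
  (DV_action P mu < +oo)%E ->
  (* the n-th term below is the image of mu under the shift by n + 1 *)
  weak_cvg (fun n => distribution mu (left_shift n.+1)) nuTI.
Proof.
move=> indP locP _ _ homP uniqTI DVmu.
exact: (weak_cvg_shift indP locP homP DVmu uniqTI).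
Qed.
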